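(* Let $r\ge 1$ be an integer, and let $A_i,C_i\in\mathbb{C}^{m\times m}$ and $B_i,D_i\in\mathbb{C}^{n\times n}$ for $i=1,\dots,r$. The system of matrix equations $$\left\{\begin{array}{ll} A_iX_iB_i-C_iX_{i+1}D_i=0, & i=1,\dots,r-1,\\ A_rX_rB_r-C_r\overline{X}_1D_r=0,\end{array}\right.$$ in the unknowns $X_1,\dots,X_r\in\mathbb{C}^{m\times n}$ has only the trivial solution $X_1=\cdots=X_r=0$ if and only if the two matrix pencils $\mathcal{P}_1(\lambda)$ and $\mathcal{P}_2(\lambda)$ described next are both regular and have disjoint spectra. The pencil $\mathcal{P}_1(\lambda)$ is the $2r\times 2r$ block matrix with diagonal blocks (top to bottom) $\lambda\overline{C}_r,\lambda\overline{C}_{r-1},\dots,\lambda\overline{C}_1,\lambda C_r,\lambda C_{r-1},\dots,\lambda C_1$, block superdiagonal (top to bottom) $\overline{A}_r,\overline{A}_{r-1},\dots,\overline{A}_1,A_r,A_{r-1},\dots,A_2$, bottom-left block $A_1$, and all other blocks zero. The pencil $\mathcal{P}_2(\lambda)$ is the $2r\times 2r$ block matrix with diagonal blocks (top to bottom) $\lambda\overline{B}_r,\lambda\overline{B}_{r-1},\dots,\lambda\overline{B}_1,\lambda B_r,\lambda B_{r-1},\dots,\lambda B_1$, block superdiagonal (top to bottom) $\overline{D}_{r-1},\overline{D}_{r-2},\dots,\overline{D}_1,D_r,D_{r-1},\dots,D_1$, bottom-left block $\overline{D}_r$, and all other blocks zero.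
   Context: $\overline{M}$ denotes the entrywise complex conjugate of a matrix $M$ (no transposition). When $r=1$ the system consists of the single equation $A_1X_1B_1-C_1\overline{X}_1D_1=0$, and the pencils are $\mathcal{P}_1(\lambda)=\begin{bmatrix} \lambda\overline{C}_1 & \overline{A}_1 \\ A_1 & \lambda C_1 \end{bmatrix}$ and $\mathcal{P}_2(\lambda)=\begin{bmatrix} \lambda\overline{B}_1 & D_1 \\ \overline{D}_1 & \lambda B_1 \end{bmatrix}$. A matrix pencil $M+\lambda N$ (with $M,N$ complex matrices of the same size) is regular if $M,N$ are square and $\det(M+\lambda N)$ is not identically zero as a polynomial in $\lambda$. For a regular pencil, $\lambda_0\in\mathbb{C}$ is a (finite) eigenvalue if $\det(M+\lambda_0N)=0$, and $\infty$ is an eigenvalue if $N$ is not invertible. The spectrum of a regular pencil is the set of all its eigenvalues, a subset of $\mathbb{C}\cup\{\infty\}$ (so disjointness of spectra also requires that $\infty$ is not a common eigenvalue). *)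

(* Defs.v *)
From HB Require Import structures.
From mathcomp Require Import all_boot all_order all_algebra.

Set Implicit Arguments.
Unset Strict Implicit.
Unset Printing Implicit Defensive.

Import Order.TTheory GRing.Theory Num.Theory.

Local Open Scope ring_scope.

(* The square pencil M + lambda N, with M = pencil_cst and N = pencil_lin. *)
Record pencil (F : fieldType) (p : nat) := Pencil {
  pencil_cst : 'M[F]_p;
  pencil_lin : 'M[F]_p
}.

Definition pencil_eval (F : fieldType) p (P : pencil F p) (z : F) : 'M[F]_p :=
  pencil_cst P + z *: pencil_lin P.

Definition pencil_polymx (F : fieldType) p (P : pencil F p) :
    'M[{poly F}]_p :=
  map_mx polyC (pencil_cst P) + 'X *: map_mx polyC (pencil_lin P).

Definition regular (F : fieldType) p (P : pencil F p) : bool :=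
  \det (pencil_polymx P) != 0.

(* A point of F together with infinity: Some z is finite, None is infinity. *)
Definition spectrum (F : fieldType) p (P : pencil F p) : pred (option F) :=
  fun z => if z is Some z0 then \det (pencil_eval P z0) == 0
           else pencil_lin P \notin unitmx.

Definition disjoint_spectra (F : fieldType) p q
    (P : pencil F p) (Q : pencil F q) : Prop :=
  forall z : option F, ~ (z \in spectrum P /\ z \in spectrum Q).

Section PeriodicSylvester.

Variable F : numClosedFieldType.

Definition conj_mx p q (M : 'M[F]_(p, q)) : 'M[F]_(p, q) :=
  map_mx (fun z : F => z^*) M.

(* Families indexed by 1..r are indexed here by 'I_r, so 0-based.
   conj_rev M is the sequence of length 2r
     conj M_r, ..., conj M_1, M_r, ..., M_1. *)
Definition conj_rev r p (M : 'I_r -> 'M[F]_p) (k : 'I_(r + r)) : 'M[F]_p :=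
  match split k with
  | inl j => conj_mx (M (rev_ord j))
  | inr j => M (rev_ord j)
  end.

Definition block_diag r p (E : 'I_(r + r) -> 'M[F]_p) :
    'M[F]_(\sum_(i < r + r) p) :=
  \mxblock_(i < r + r, j < r + r) (if i == j then E i else 0).

(* E lists the 2r - 1 superdiagonal blocks from top to bottom, followed by
   the bottom-left block. *)
Definition block_super_row r p (E : 'I_(r + r) -> 'M[F]_p) :
    'M[F]_(\sum_(i < r + r) p) :=
  \mxblock_(i < r + r, j < r + r)
    (if (j == i.+1 :> nat) || ((i.+1 == r + r)%N && (j == 0%N :> nat))
     then E i else 0).

(* E lists the bottom-left block, followed by the 2r - 1 superdiagonal blocks
   from top to bottom. *)
Definition block_super_col r p (E : 'I_(r + r) -> 'M[F]_p) :
    'M[F]_(\sum_(i < r + r) p) :=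
  \mxblock_(i < r + r, j < r + r)
    (if (j == i.+1 :> nat) || ((i.+1 == r + r)%N && (j == 0%N :> nat))
     then E j else 0).

(* Superdiagonal conj A_r, ..., conj A_1, A_r, ..., A_2; bottom-left A_1. *)
Definition pencil1 r m (A C : 'I_r -> 'M[F]_m) :
    pencil F (\sum_(i < r + r) m) :=
  Pencil (block_super_row (conj_rev A)) (block_diag (conj_rev C)).

(* Superdiagonal conj D_(r-1), ..., conj D_1, D_r, ..., D_1;
   bottom-left conj D_r. *)
Definition pencil2 r n (B D : 'I_r -> 'M[F]_n) :
    pencil F (\sum_(i < r + r) n) :=
  Pencil (block_super_col (conj_rev D)) (block_diag (conj_rev B)).

Definition is_solution r m n (A C : 'I_r -> 'M[F]_m) (B D : 'I_r -> 'M[F]_n)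
    (X : 'I_r -> 'M[F]_(m, n)) : Prop :=
  (forall i j : 'I_r, j = i.+1 :> nat ->
     A i *m X i *m B i - C i *m X j *m D i = 0) /\
  (forall i j : 'I_r, i.+1 = r -> j = 0%N :> nat ->
     A i *m X i *m B i - C i *m conj_mx (X j) *m D i = 0).

End PeriodicSylvester.

(* Main.v *)
Require Import Defs.
From HB Require Import structures.
From mathcomp Require Import all_boot all_order all_algebra.
From mathcomp Require Import reals complex.

Set Implicit Arguments.
Unset Strict Implicit.
Unset Printing Implicit Defensive.

Import Order.TTheory GRing.Theory Num.Theory.

Local Open Scope ring_scope.

(* The conjugate system in X_1, ..., X_r is trivially solvable exactly when the
   C-linear cyclic system with 2r unknowns, obtained by appending the conjugate
   equations, is.  The latter is one of 2r cyclic systems, differing by a shift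
   of the indices of B and D, into which the generalized Sylvester equation
   M1 Z N2 = N1 Z M2 for the two pencils M + lambda N splits block-diagonal by
   block-diagonal.  All these shifted systems have the same determinant: when B
   and D are invertible a change of unknowns conjugates one into the next, and
   the general case follows by perturbing B and D over F[X].  Finally the
   Sylvester equation is trivially solvable iff the pencils are regular with
   disjoint spectra: a common eigenvalue gives a rank one solution, and
   conversely a shift of both pencils to a regular point reduces to an ordinary
   Sylvester equation, handled by Cayley-Hamilton. *)

(** * Spectra of pencils and the generalized Sylvester equation *)

Section GeneralizedSylvester.

Variable F : numClosedFieldType.

Definition sylvester_injective p q (P : pencil F p) (Q : pencil F q) : Prop :=
  forall Z : 'M[F]_(p, q),
    pencil_cst P *m Z *m pencil_lin Q = pencil_lin P *m Z *m pencil_cst Q ->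
    Z = 0.

Lemma det_pencil_eval p (P : pencil F p) z :
  \det (pencil_eval P z) = (\det (pencil_polymx P)).[z].
Proof.
rewrite -horner_evalE -det_map_mx; congr (\det _).
by apply/matrixP => i j; rewrite !mxE /= /horner_eval !hornerE.
Qed.

(** Factoring out the invertible N leaves M + X N = N (X + N^-1 M). *)
Lemma det_pencil_polymx_lin_unit p (P : pencil F p) :
    pencil_lin P \in unitmx ->
  \det (pencil_polymx P) =
    (\det (pencil_lin P))%:P
      * char_poly (- (invmx (pencil_lin P) *m pencil_cst P)).
Proof.
move=> uN; rewrite -det_map_mx -det_mulmx; congr (\det _).
rewrite /char_poly_mx map_mxN opprK mulmxDr -map_mxM /= mulKVmx //.
by rewrite addrC mul_mx_scalar.
Qed.

Lemma regular_lin_unit p (P : pencil F p) :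
  pencil_lin P \in unitmx -> regular P.
Proof.
move=> uN; rewrite /regular det_pencil_polymx_lin_unit // mulf_neq0 //.
  by rewrite polyC_eq0 -unitfE -unitmxE.
exact/monic_neq0/char_poly_monic.
Qed.

Lemma nonregular_spectrum p (P : pencil F p) z :
  ~~ regular P -> z \in spectrum P.
Proof.
move=> nP; case: z => [z|]; rewrite unfold_in /=.
  by rewrite det_pencil_eval; move/negPn/eqP: nP => ->; rewrite horner0.
by apply: contra nP; apply: regular_lin_unit.
Qed.

(** Either N is singular and infinity is an eigenvalue, or a characteristic polynomial of positive
    degree has a root. Together with [nonregular_spectrum], this yields a common eigenvalue as soon
    as one pencil is not regular. *)
Lemma spectrum_neq0 p (P : pencil F p) :
  (0 < p)%N -> exists z, z \in spectrum P.
Proof.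
move=> p_gt0; have [uN|nuN] := boolP (pencil_lin P \in unitmx); last first.
  by exists None.
have [z rz] : {z | root (char_poly (- (invmx (pencil_lin P) *m pencil_cst P))) z}.
  by apply/sigW/closed_rootP; rewrite size_char_poly eqSS -lt0n.
exists (Some z); rewrite unfold_in /= det_pencil_eval.
by rewrite det_pencil_polymx_lin_unit // hornerM (eqP rz) mulr0.
Qed.

Lemma det0_col p (M : 'M[F]_p) :
  \det M = 0 -> exists2 x : 'cV_p, x != 0 & M *m x = 0.
Proof.
rewrite -det_tr => /eqP/det0P[v v0 vM]; exists v^T.
  by apply: contraNneq v0 => /(congr1 trmx); rewrite trmxK trmx0 => ->.
by apply: (can_inj (@trmxK _ _ _)); rewrite trmx_mul trmxK vM trmx0.
Qed.

Lemma outer_neq0 p q (x : 'cV[F]_p) (y : 'rV[F]_q) :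
  x != 0 -> y != 0 -> x *m y != 0.
Proof.
move=> /cV0Pn[i xi] /rV0Pn[j yj]; apply/matrix0Pn; exists i, j.
by rewrite !mxE big_ord1 mulf_neq0.
Qed.

Lemma common_spectrum_not_injective p q (P : pencil F p) (Q : pencil F q) z :
  z \in spectrum P -> z \in spectrum Q -> ~ sylvester_injective P Q.
Proof.
move=> zP zQ inj.
suff [x x0 [y y0 e]] : exists2 x : 'cV[F]_p, x != 0 &
    exists2 y : 'rV[F]_q, y != 0 &
    pencil_cst P *m (x *m y) *m pencil_lin Q
      = pencil_lin P *m (x *m y) *m pencil_cst Q.
  by move/eqP: (inj _ e); apply/negP; rewrite outer_neq0.
(* Take x in the right kernel of P(z) and y in the left kernel of Q(z). For finite z both sides
   equal -z N1 x y N2; at infinity both vanish. *)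
case: z => [z|] in zP zQ *;
  rewrite [_ \in _]unfold_in /= in zP; rewrite [_ \in _]unfold_in /= in zQ.
  have [x x0 /eqP] := det0_col (eqP zP).
  rewrite mulmxDl addr_eq0 -scalemxAl => /eqP Px.
  have /det0P[y y0 /eqP] := zQ.
  rewrite mulmxDr addr_eq0 -scalemxAr => /eqP yQ.
  exists x => //; exists y => //.
  rewrite !mulmxA Px -!mulmxA yQ !mulNmx !mulmxN.
  by rewrite -!scalemxAl -!scalemxAr mulmxA.
rewrite !unitmxE !unitfE !negbK in zP zQ.
have [x x0 Px] := det0_col (eqP zP); have /det0P[y y0 yQ] := zQ.
exists x => //; exists y => //.
by rewrite !mulmxA Px -!mulmxA yQ !(mul0mx, mulmx0).
Qed.

(* Every factor [K - z] of the characteristic polynomial of [L], evaluated at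
   [K], is invertible, while Cayley-Hamilton kills it on [L]. *)
Lemma sylvester_disjoint_eigenvalues p q (K : 'M[F]_p) (L : 'M[F]_q) Z :
    (forall z, ~ (\det (K - z%:M) = 0 /\ \det (L - z%:M) = 0)) ->
  K *m Z = Z *m L -> Z = 0.
Proof.
case: q => [|q] in L Z *; first by move=> *; rewrite thinmx0.
case: p => [|p] in K Z *; first by move=> *; rewrite flatmx0.
move=> dis e.
have comm (f : {poly F}) : horner_mx K f *m Z = Z *m horner_mx L f.
  elim/poly_ind: f => [|f c IH]; first by rewrite !rmorph0 mul0mx mulmx0.
  rewrite !rmorphD !rmorphM /= !horner_mx_X !horner_mx_C mulmxDl mulmxDr.
  rewrite mul_scalar_mx mul_mx_scalar; congr (_ + _).
  by rewrite -!mulmxE -mulmxA e !mulmxA IH.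
have u : horner_mx K (char_poly L) \in unitmx.
  have [s Es] := closed_field_poly_normal (char_poly L).
  have sP z : z \in s -> \det (L - z%:M) = 0.
    move=> zs; have : root (char_poly L) z.
      rewrite Es rootZ ?root_prod_XsubC //.
      by rewrite lead_coef_eq0 monic_neq0 // char_poly_monic.
    rewrite -eigenvalue_root_char => /eigenvalueP[v vL v0].
    apply/eqP/det0P; exists v => //.
    by rewrite mulmxBr vL mul_mx_scalar subrr.
  rewrite Es (monicP (char_poly_monic L)) scale1r rmorph_prod /= big_seq.
  elim/big_ind: _ => [|M N uM uN|z /sP Lz]; first exact: unitmx1.
    by rewrite -mulmxE unitmx_mul uM.
  rewrite rmorphB /= horner_mx_X horner_mx_C unitmxE unitfE.
  by apply/eqP => Kz; apply: (dis z).
by apply: (can_inj (mulKmx u)); rewrite comm Cayley_Hamilton !mulmx0.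
Qed.

Theorem sylvester_injectiveP p q (P : pencil F p) (Q : pencil F q) :
    (0 < p)%N -> (0 < q)%N ->
  sylvester_injective P Q <->
  [/\ regular P, regular Q & disjoint_spectra P Q].
Proof.
move=> p_gt0 q_gt0; split=> [inj|[rP rQ dis] Z e].
  split=> [||z [zP zQ]]; last exact: common_spectrum_not_injective zP zQ inj.
    have [//|nP] := boolP (regular P); have [z zQ] := spectrum_neq0 Q q_gt0.
    by case: (common_spectrum_not_injective (nonregular_spectrum z nP) zQ inj).
  have [//|nQ] := boolP (regular Q); have [z zP] := spectrum_neq0 P p_gt0.
  by case: (common_spectrum_not_injective zP (nonregular_spectrum z nQ) inj).
(* Replacing the constant terms by the invertible values at a common regular
   point [c] preserves the equation and turns it into a Sylvester equation. *)
have [c [uP uQ]] : exists c,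
    pencil_eval P c \in unitmx /\ pencil_eval Q c \in unitmx.
  pose f := \det (pencil_polymx P) * \det (pencil_polymx Q).
  have f0 : f != 0 by exact: (mulf_neq0 rP rQ).
  (* These [size f] points are distinct in characteristic zero, too many to be all roots of [f]. *)
  pose s : seq F := [seq i%:R | i <- iota 0 (size f)].
  have us : uniq s.
    by rewrite map_inj_uniq ?iota_uniq //; apply: (mulrIn (oner_neq0 F)).
  have : ~~ all (root f) s.
    apply: contraTN us => /(max_poly_roots f0) h; apply/negP => /h.
    by rewrite size_map size_iota ltnn.
  case/allPn => c _; rewrite /root hornerM mulf_eq0 negb_or => /andP[a b].
  by exists c; rewrite !unitmxE !unitfE !det_pencil_eval.
pose G := pencil_eval P c; pose H := pencil_eval Q c.
have e' : G *m Z *m pencil_lin Q = pencil_lin P *m Z *m H.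
  by rewrite !mulmxDl mulmxDr e -!scalemxAl -scalemxAr.
apply: (@sylvester_disjoint_eigenvalues _ _ (invmx G *m pencil_lin P)
         (pencil_lin Q *m invmx H)); last first.
  rewrite -mulmxA; apply: (can_inj (mulKmx uP)); rewrite mulKVmx //.
  by apply: (can_inj (mulmxK uQ)); rewrite -e' !mulmxA mulmxKV.
move=> t [tP tQ].
have {tP}tP : \det (pencil_lin P - t *: G) = 0.
  rewrite -[pencil_lin P](mulKVmx uP) -mul_mx_scalar -mulmxBr det_mulmx.
  by rewrite tP mulr0.
have {tQ}tQ : \det (pencil_lin Q - t *: H) = 0.
  rewrite -[pencil_lin Q](mulmxKV uQ) -mul_scalar_mx -mulmxBl det_mulmx.
  by rewrite tQ mul0r.
(* Since N - t (M + c N) = -t (M + (c - 1/t) N), the value t = 0 corresponds to the eigenvalue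
   infinity and any other t to c - 1/t. *)
have [t0|t0] := eqVneq t 0.
  apply: (dis None); rewrite ![None \in _]unfold_in /= !unitmxE !unitfE !negbK.
  by move: tP tQ; rewrite t0 !scale0r !subr0 => -> ->.
have shift k (S : pencil F k) : \det (pencil_lin S - t *: pencil_eval S c) = 0 ->
    Some (c - t^-1) \in spectrum S.
  move=> S0; rewrite unfold_in /=; suff -> : pencil_eval S (c - t^-1) =
    (- t^-1) *: (pencil_lin S - t *: pencil_eval S c) by rewrite detZ S0 mulr0.
  rewrite /pencil_eval scalerBr scalerA mulNr mulVf // scaleN1r opprK.
  by rewrite scalerBl scaleNr addrA addrC.
by apply: (dis (Some (c - t^-1))); split; apply: shift.
Qed.

End GeneralizedSylvester.

(** * Determinants of linear operators on matrix spaces *)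

Section LinMxComp.

Variables (R : comNzRingType) (a b : nat).
Implicit Types f g h k : {linear 'M[R]_(a, b) -> 'M[R]_(a, b)}.

Lemma det_lin_mx_comp f g h :
  (forall V, h V = f (g V)) ->
  \det (lin_mx h) = \det (lin_mx f) * \det (lin_mx g).
Proof.
move=> e; rewrite mulrC -det_mulmx; congr (\det _); apply/row_matrixP => i.
by rewrite !rowE mulmxA !mul_rV_lin mxvecK e.
Qed.

(** The form in which intertwining relations between operators are used below. *)
Lemma det_lin_mx_comm f g h k :
    (forall V, f (g V) = h (k V)) ->
  \det (lin_mx f) * \det (lin_mx g) = \det (lin_mx h) * \det (lin_mx k).
Proof.
move=> e; rewrite -(@det_lin_mx_comp f g (f \o g)) //.
exact: (@det_lin_mx_comp h k (f \o g)).
Qed.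

Lemma det_lin_mx_can f g :
  cancel f g -> \det (lin_mx g) * \det (lin_mx f) = 1.
Proof.
move=> fK; rewrite -(@det_lin_mx_comp g f idfun) => [|V]; last by rewrite fK.
rewrite -[RHS](det1 R (a * b)); congr (\det _).
by apply/row_matrixP => i; rewrite !rowE mul_rV_lin mulmx1 /= vec_mxK.
Qed.

End LinMxComp.

Lemma det_lin_mx_neq0P (K : fieldType) a b
    (f : {linear 'M[K]_(a, b) -> 'M[K]_(a, b)}) :
  (forall V, f V = 0 -> V = 0) <-> \det (lin_mx f) != 0.
Proof.
split=> [inj|].
  apply/negP => /det0P[v v0]; rewrite mul_rV_lin => /(congr1 vec_mx).
  rewrite mxvecK linear0 => /inj /(congr1 mxvec); rewrite vec_mxK linear0.
  by apply/eqP.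
move=> /negP d V fV; apply/eqP/negPn/negP => V0; apply/d/det0P.
exists (mxvec V); last by rewrite mul_vec_lin fV linear0.
by apply: contraNneq V0 => /(congr1 vec_mx); rewrite mxvecK linear0 => ->.
Qed.

(** * Cyclic systems as linear operators *)

(* A family of N matrices of size m x n is stored as the N x (m n) matrix
   of its vectorisations. *)
Section PeriodicOperator.

Variables (R : comNzRingType) (N m n : nat) (s : 'I_N -> 'I_N).

Definition mx_member (k : 'I_N) (V : 'M[R]_(N, m * n)) : 'M[R]_(m, n) :=
  vec_mx (row k V).

Definition mx_family (f : 'I_N -> 'M[R]_(m, n)) : 'M[R]_(N, m * n) :=
  \matrix_k mxvec (f k).

Lemma mx_familyK f k : mx_member k (mx_family f) = f k.
Proof. by rewrite /mx_member rowK mxvecK. Qed.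

Lemma mx_memberP V W : (forall k, mx_member k V = mx_member k W) -> V = W.
Proof.
move=> e; apply/row_matrixP => k.
exact: (can_inj (@vec_mxK _ _ _) (e k)).
Qed.

Lemma mx_member_is_linear k : linear (mx_member k).
Proof. by move=> a V W; rewrite /mx_member !linearP. Qed.

HB.instance Definition _ k :=
  GRing.isLinear.Build R _ _ _ (mx_member k) (mx_member_is_linear k).

(** The base is any commutative ring, so that polynomial coefficients are allowed. *)
Definition periodic_op (A C : 'I_N -> 'M[R]_m) (B D : 'I_N -> 'M[R]_n) V :=
  mx_family (fun k => A k *m mx_member k V *m B k
                       - C k *m mx_member (s k) V *m D k).

Definition mulr_op (G : 'I_N -> 'M[R]_n) V :=
  mx_family (fun k => mx_member k V *m G k).

Definition shift_op (t : 'I_N -> 'I_N) V :=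
  mx_family (fun k => mx_member (t k) V).

Lemma periodic_op_is_linear A C B D : linear (periodic_op A C B D).
Proof.
move=> a V W; apply: mx_memberP => k.
rewrite linearP /= /periodic_op !mx_familyK !linearP /= !mulmxDl -!scalemxAl.
by rewrite opprD addrACA -scalerBr.
Qed.

Lemma mulr_op_is_linear G : linear (mulr_op G).
Proof.
move=> a V W; apply: mx_memberP => k.
by rewrite linearP /= /mulr_op !mx_familyK linearP /= mulmxDl -scalemxAl.
Qed.

Lemma shift_op_is_linear t : linear (shift_op t).
Proof.
move=> a V W; apply: mx_memberP => k.
by rewrite linearP /= /shift_op !mx_familyK linearP.
Qed.

HB.instance Definition _ A C B D :=
  GRing.isLinear.Build R _ _ _ (periodic_op A C B D)
    (periodic_op_is_linear A C B D).
HB.instance Definition _ G :=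
  GRing.isLinear.Build R _ _ _ (mulr_op G) (mulr_op_is_linear G).
HB.instance Definition _ t :=
  GRing.isLinear.Build R _ _ _ (shift_op t) (shift_op_is_linear t).

Lemma shift_opK t u : cancel t u -> cancel (shift_op u) (shift_op t).
Proof.
by move=> tK V; apply: mx_memberP => k; rewrite /shift_op !mx_familyK tK.
Qed.

End PeriodicOperator.

(** * Invariance of the determinant under a shift of B and D *)

Section ShiftInvariance.

Variables (N m n : nat) (s : 'I_N -> 'I_N).
Hypothesis s_bij : bijective s.

Lemma eq_det_periodic_op (R : comNzRingType) (A A' C C' : 'I_N -> 'M[R]_m)
    (B B' D D' : 'I_N -> 'M[R]_n) :
    A =1 A' -> C =1 C' -> B =1 B' -> D =1 D' ->
  \det (lin_mx (periodic_op s A C B D))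
    = \det (lin_mx (periodic_op s A' C' B' D')).
Proof.
move=> eA eC eB eD; congr (\det _); apply/row_matrixP => i.
rewrite !rowE !mul_rV_lin /=; congr mxvec; apply: mx_memberP => k.
by rewrite /periodic_op !mx_familyK eA eC eB eD.
Qed.

(** The shift of the unknowns intertwines the two multiplications, and its determinant is a unit
    because [s] is bijective. *)
Lemma det_mulr_op_shift (R : comNzRingType) (G : 'I_N -> 'M[R]_n) :
  \det (lin_mx (@mulr_op R N m n (G \o s))) = \det (lin_mx (@mulr_op R N m n G)).
Proof.
case: s_bij => t sK tK.
have d1 := det_lin_mx_can (@shift_opK R N m n _ _ sK).
have e : \det (lin_mx (@mulr_op R N m n (G \o s)))
      * \det (lin_mx (@shift_op R N m n s))
    = \det (lin_mx (@shift_op R N m n s)) * \det (lin_mx (@mulr_op R N m n G)).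
  apply: det_lin_mx_comm => V.
  by apply: mx_memberP => k; rewrite /mulr_op /shift_op !mx_familyK.
by rewrite -[LHS]mulr1 -d1 mulrA e -mulrA [X in _ * X]mulrC mulrA d1 mul1r.
Qed.

Lemma det_mulr_op_unit (K : fieldType) (G : 'I_N -> 'M[K]_n) :
  (forall k, G k \in unitmx) -> \det (lin_mx (@mulr_op K N m n G)) != 0.
Proof.
move=> uG; apply/det_lin_mx_neq0P => V V0; apply: mx_memberP => k.
have := congr1 (mx_member k) V0; rewrite mx_familyK !linear0 => e.
by apply: (can_inj (mulmxK (uG k))); rewrite e mul0mx.
Qed.

Lemma det_periodic_op_shift_unit (K : fieldType)
    (A C : 'I_N -> 'M[K]_m) (B D : 'I_N -> 'M[K]_n) :
    (forall k, B k \in unitmx) -> (forall k, D k \in unitmx) ->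
  \det (lin_mx (periodic_op s A C (B \o s) (D \o s)))
    = \det (lin_mx (periodic_op s A C B D)).
Proof.
move=> uB uD; pose Di k := invmx (D k).
have uDi k : Di k \in unitmx by rewrite unitmx_inv.
have dB := det_mulr_op_unit uB; have dDi := det_mulr_op_unit uDi.
(* Multiplying the k-th unknown by B_k D_k^-1 on the right shifts the indices
   of B and D, up to multiplying the k-th equation by D_k^-1 B_(s k). *)
pose G k := B k *m Di k; pose H k := Di k *m B (s k).
have dM (G1 G2 : 'I_N -> 'M[K]_n) :
    \det (lin_mx (@mulr_op K N m n (fun k => G1 k *m G2 k)))
    = \det (lin_mx (@mulr_op K N m n G2)) * \det (lin_mx (@mulr_op K N m n G1)).
  apply: det_lin_mx_comp => V; apply: mx_memberP => k.
  by rewrite /mulr_op !mx_familyK mulmxA.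
have e : \det (lin_mx (periodic_op s A C (B \o s) (D \o s)))
           * \det (lin_mx (@mulr_op K N m n G))
       = \det (lin_mx (@mulr_op K N m n H))
           * \det (lin_mx (periodic_op s A C B D)).
  apply: det_lin_mx_comm => V; apply: mx_memberP => k.
  rewrite /mulr_op /periodic_op !mx_familyK /= !mulmxBl /G /H /Di !mulmxA.
  by rewrite mulmxKV // mulmxK.
(* By shift invariance the multipliers [G] and [H] have the same nonzero determinant, which
   cancels. *)
move: e; rewrite (dM B Di) (dM Di (B \o s)) det_mulr_op_shift => e.
by apply: (mulIf (mulf_neq0 dDi dB)); rewrite e mulrC [X in _ * X]mulrC.
Qed.

Lemma map_periodic_op (R S : comNzRingType) (f : {rmorphism R -> S})
    (A C : 'I_N -> 'M[R]_m) (B D : 'I_N -> 'M[R]_n) :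
  f (\det (lin_mx (periodic_op s A C B D)))
    = \det (lin_mx (periodic_op s (map_mx f \o A) (map_mx f \o C)
                                  (map_mx f \o B) (map_mx f \o D))).
Proof.
rewrite -det_map_mx; congr (\det _); apply: map_lin_mx => V.
have mE k W : map_mx f (mx_member k W) = mx_member k (map_mx f W).
  by rewrite /mx_member map_vec_mx map_row.
apply: mx_memberP => k; rewrite -mE /periodic_op !mx_familyK.
by rewrite raddfB /= !map_mxM /= !mE.
Qed.

(* Over F(X) the shifted families B + X and D + X are invertible; the identity
   obtained there lives in F[X] and specialises at X = 0. *)
Lemma det_periodic_op_shift (F : fieldType)
    (A C : 'I_N -> 'M[F]_m) (B D : 'I_N -> 'M[F]_n) :
  \det (lin_mx (periodic_op s A C (B \o s) (D \o s)))
    = \det (lin_mx (periodic_op s A C B D)).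
Proof.
pose cst p (E : 'I_N -> 'M[F]_p) k := map_mx polyC (E k).
(* This is the matrix E_k + X; its determinant is monic, hence nonzero. *)
pose gen (E : 'I_N -> 'M[F]_n) k : 'M[{poly F}]_n := char_poly_mx (- E k).
pose frac p (E : 'I_N -> 'M[{poly F}]_p) k := map_mx (@tofrac _) (E k).
have u E k : frac n (gen E) k \in unitmx.
  rewrite unitmxE det_map_mx unitfE tofrac_eq0.
  exact/monic_neq0/char_poly_monic.
have e :
    \det (lin_mx (periodic_op s (cst m A) (cst m C) (gen B \o s) (gen D \o s)))
    = \det (lin_mx (periodic_op s (cst m A) (cst m C) (gen B) (gen D))).
  pose phi : {rmorphism {poly F} -> {fraction {poly F}}} := @tofrac {poly F}.
  have phi_inj : injective phi by move=> x y /eqP; rewrite tofrac_eq => /eqP.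
  have h := map_periodic_op phi (cst m A) (cst m C) (gen B \o s) (gen D \o s).
  have h' := map_periodic_op phi (cst m A) (cst m C) (gen B) (gen D).
  refine (phi_inj _ _ (etrans h (etrans _ (esym h')))).
  exact: (det_periodic_op_shift_unit (frac m (cst m A)) (frac m (cst m C))
    (u B) (u D)).
have ev0 p (E : 'I_N -> 'M[F]_p) k : map_mx (horner_eval 0) (cst p E k) = E k.
  by apply/matrixP => i j; rewrite !mxE /= /horner_eval hornerC.
have evg (E : 'I_N -> 'M[F]_n) k : map_mx (horner_eval 0) (gen E k) = E k.
  apply/matrixP => i j; rewrite !mxE /= /horner_eval.
  by rewrite hornerD hornerN hornerMn hornerX hornerC mul0rn sub0r opprK.
pose psi : {rmorphism {poly F} -> F} := horner_eval 0.
have h := map_periodic_op psi (cst m A) (cst m C) (gen B \o s) (gen D \o s).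
have h' := map_periodic_op psi (cst m A) (cst m C) (gen B) (gen D).
have {}e := etrans (esym h) (etrans (congr1 psi e) h').
by move: e; congr (_ = _); apply: eq_det_periodic_op => k; rewrite /= ?ev0 ?evg.
Qed.

Lemma periodic_op_inj_iter (F : fieldType) e
    (A C : 'I_N -> 'M[F]_m) (B D : 'I_N -> 'M[F]_n) :
    (forall V, periodic_op s A C B D V = 0 -> V = 0) ->
  forall V, periodic_op s A C (B \o iter e s) (D \o iter e s) V = 0 -> V = 0.
Proof.
move=> /det_lin_mx_neq0P inj; apply/det_lin_mx_neq0P.
elim: e => [|e IH]; first exact: inj.
rewrite -(det_periodic_op_shift A C (B \o iter e s) (D \o iter e s)) in IH.
rewrite -(eq_det_periodic_op (fun=> erefl) (fun=> erefl)
  (B := B \o iter e s \o s) (D := D \o iter e s \o s)) // => k /=;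
  by rewrite -iterSr.
Qed.

End ShiftInvariance.

(** * Splitting the Sylvester equation along cyclic block diagonals *)

Section BlockPencils.

Variables (F : numClosedFieldType) (r m n : nat).
Local Notation N := (r + r)%N.
Implicit Types (A C : 'I_N -> 'M[F]_m) (B D : 'I_N -> 'M[F]_n).
Implicit Types Z : 'I_N -> 'I_N -> 'M[F]_(m, n).

(** The bottom-left corner is where the superdiagonal wraps around, so the block pattern is that of
    the cyclic successor. *)
Lemma eq_ordS (i j : 'I_N) :
  (j == i.+1 :> nat) || ((i.+1 == N)%N && (j == 0%N :> nat)) = (j == ordS i).
Proof.
rewrite -[RHS]val_eqE /=; have := ltn_ord i; rewrite leq_eqVlt.
case/predU1P => [e|ltiN]; last by rewrite modn_small // (ltn_eqF ltiN) orbF.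
by rewrite e modnn eqxx /= [j == N :> nat]ltn_eqF.
Qed.

Lemma sum_single (V : nmodType) (I : finType) (f : I -> V) i :
  (forall k, k != i -> f k = 0) -> \sum_k f k = f i.
Proof. by move=> f0; rewrite (bigD1 i) //= big1 ?addr0. Qed.

Lemma mul_block_super_row A B Z :
  block_super_row A *m \mxblock_(i, j) Z i j *m block_diag B
    = \mxblock_(i, j) (A i *m Z (ordS i) j *m B j).
Proof.
rewrite !mul_mxblock; apply/eq_mxblock => i j.
rewrite (@sum_single _ _ _ j) => [|k kj]; last by rewrite (negPf kj) mulmx0.
rewrite eqxx (@sum_single _ _ _ (ordS i)) ?eq_ordS ?eqxx // => k ki.
by rewrite eq_ordS (negPf ki) mul0mx.
Qed.

Lemma mul_block_super_col C D Z :
  block_diag C *m \mxblock_(i, j) Z i j *m block_super_col D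
    = \mxblock_(i, j) (C i *m Z i (ord_pred j) *m D j).
Proof.
rewrite !mul_mxblock; apply/eq_mxblock => i j.
rewrite (@sum_single _ _ _ (ord_pred j)) => [|k kj]; last first.
  rewrite eq_ordS; case: eqP => [jk|_]; last by rewrite mulmx0.
  by rewrite jk ordSK eqxx in kj.
rewrite eq_ordS ord_predK eqxx (@sum_single _ _ _ i) ?eqxx // => k ki.
by rewrite eq_sym (negPf ki) mul0mx.
Qed.

Lemma val_iter_ordS e (j : 'I_N) :
  iter e (@ordS N) j = ((j + e) %% N)%N :> nat.
Proof.
elim: e => [|e IH]; first by rewrite addn0 modn_small.
by rewrite iterS /= IH -addn1 modnDml addn1 addnS.
Qed.

Lemma iter_ord_pred_onto (i j : 'I_N) : exists e, j = iter e (@ord_pred N) i.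
Proof.
(* As j < N the subtraction is exact, and j + e = i + N is i modulo N. *)
exists (i + (N - j))%N; have : i = iter (i + (N - j)) (@ordS N) j.
  apply: ord_inj; rewrite val_iter_ordS addnCA subnKC ?(ltnW (ltn_ord j)) //.
  by rewrite modnDr modn_small.
move: (i + _)%N => e ->.
by elim: e => [|e IH] //; rewrite iterSr (iterS e (@ordS N)) ordSK.
Qed.

Lemma sylvester_injective_block A C B D :
  sylvester_injective (Pencil (block_super_row A) (block_diag C))
                      (Pencil (block_super_col D) (block_diag B)) <->
  (forall V : 'M[F]_(N, m * n),
     periodic_op (@ord_pred N) A C B D V = 0 -> V = 0).
Proof.
split=> inj.
  (* A solution of the unshifted system is placed on one cyclic block diagonal, with zeros
     elsewhere. *)
  move=> V V0; pose Z i j := if i == ordS j then mx_member j V else 0 : 'M_(m, n).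
  have /eq_mxblockP Z0 : \mxblock_(i, j) Z i j = \mxblock_(i, j) (0 : 'M_(m, n)).
    rewrite [RHS]mxblock0; apply: inj.
    rewrite /= mul_block_super_row mul_block_super_col; apply/eq_mxblock => i j.
    rewrite /Z (inj_eq (@ordS_inj N)) ord_predK.
    case: eqP => [<-|_]; last by rewrite !(mulmx0, mul0mx).
    apply/eqP; rewrite -subr_eq0; apply/eqP.
    by have := congr1 (mx_member i) V0; rewrite mx_familyK linear0.
  by apply: mx_memberP => k; have := Z0 (ordS k) k; rewrite /Z eqxx linear0.
move=> Z0; rewrite -[Z0]submxblockK; set Z := fun i j => submxblock Z0 i j.
rewrite /= mul_block_super_row mul_block_super_col => /eq_mxblockP eZ.
rewrite -[RHS](mxblock0); apply/eq_mxblock => i j.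
(* Conversely, the block (i, j) lies on the cyclic diagonal of blocks (k + 1, k - e), whose entries
   solve the system with B and D shifted by e. *)
have [e ->] := iter_ord_pred_onto (ord_pred i) j.
pose V : 'M_(N, m * n) :=
  mx_family (fun k => Z (ordS k) (iter e (@ord_pred N) k)).
suff V0 : V = 0.
  have := congr1 (mx_member (ord_pred i)) V0.
  by rewrite mx_familyK linear0 ord_predK.
apply: (periodic_op_inj_iter (ord_pred_bij N) (e := e) inj).
apply: mx_memberP => k; rewrite !mx_familyK linear0 /= eZ ord_predK -iterSr iterS.
exact: subrr.
Qed.

End BlockPencils.

(** * From the conjugate system to a linear cyclic system of length 2r *)

Section ConjugateSystem.

Variables (F : numClosedFieldType) (r m n : nat).
Local Notation N := (r + r)%N.
Implicit Types (A C : 'I_r -> 'M[F]_m) (B D : 'I_r -> 'M[F]_n).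
Implicit Types X : 'I_r -> 'M[F]_(m, n).

(** Extends [conj_rev] to rectangular matrices, so that it applies to the unknowns; on square ones
    the two are convertible. *)
Definition conj_rev_rect p q (M : 'I_r -> 'M[F]_(p, q)) (k : 'I_N)
  : 'M[F]_(p, q) :=
  match split k with
  | inl j => conj_mx (M (rev_ord j))
  | inr j => M (rev_ord j)
  end.

(** The antipodal map of the 2r-cycle, which exchanges the conjugated half and the plain half. *)
Definition half_turn : 'I_N -> 'I_N := iter r (@ordS N).

Lemma half_turn_lshift j : half_turn (lshift r j) = rshift r j.
Proof.
apply: ord_inj; rewrite /half_turn val_iter_ordS /= addnC modn_small //.
by rewrite ltn_add2l.
Qed.

Lemma half_turn_rshift j : half_turn (rshift r j) = lshift r j.
Proof.
apply: ord_inj; rewrite /half_turn val_iter_ordS /= addnAC modnDl modn_small //.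
exact: ltn_addr.
Qed.

Lemma ord_pred_half_turn k : ord_pred (half_turn k) = half_turn (ord_pred k).
Proof.
by apply: (@ordS_inj N); rewrite ord_predK /half_turn -iterS iterSr ord_predK.
Qed.

Lemma conj_rev_lshift p q (M : 'I_r -> 'M[F]_(p, q)) i :
  conj_rev_rect M (lshift r (rev_ord i)) = conj_mx (M i).
Proof.
rewrite /conj_rev_rect; case: split_ordP => j; last first.
  by move/eqP; rewrite eq_lrshift.
by move=> /lshift_inj <-; rewrite rev_ordK.
Qed.

Lemma conj_rev_rshift p q (M : 'I_r -> 'M[F]_(p, q)) i :
  conj_rev_rect M (rshift r (rev_ord i)) = M i.
Proof.
rewrite /conj_rev_rect; case: split_ordP => j.
  by move/eqP; rewrite eq_rlshift.
by move=> /rshift_inj <-; rewrite rev_ordK.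
Qed.

Lemma conj_mxK p q : involutive (@conj_mx F p q).
Proof. by move=> M; apply/matrixP => i j; rewrite !mxE conjCK. Qed.

Lemma conj_mxM p q k (M : 'M[F]_(p, q)) (M' : 'M[F]_(q, k)) :
  conj_mx (M *m M') = conj_mx M *m conj_mx M'.
Proof. exact: map_mxM. Qed.

Lemma conj_mxB p q (M M' : 'M[F]_(p, q)) :
  conj_mx (M - M') = conj_mx M - conj_mx M'.
Proof. exact: map_mxB. Qed.

Lemma conj_mxD p q (M M' : 'M[F]_(p, q)) :
  conj_mx (M + M') = conj_mx M + conj_mx M'.
Proof. exact: map_mxD. Qed.

Lemma conj_mxZ p q a (M : 'M[F]_(p, q)) : conj_mx (a *: M) = a^* *: conj_mx M.
Proof. exact: map_mxZ. Qed.

Lemma conj_mx0 p q : conj_mx (0 : 'M[F]_(p, q)) = 0.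
Proof. exact: map_mx0. Qed.

Lemma conj_rev_half_turn p q (M : 'I_r -> 'M[F]_(p, q)) k :
  conj_rev_rect M (half_turn k) = conj_mx (conj_rev_rect M k).
Proof.
case: (split_ordP k) => j ->; rewrite -[j]rev_ordK.
  by rewrite half_turn_lshift conj_rev_lshift conj_rev_rshift conj_mxK.
by rewrite half_turn_rshift conj_rev_lshift conj_rev_rshift.
Qed.

(** The families are listed in reverse, so the next unknown sits at the preceding position. *)
Lemma ord_pred_rshift (i j : 'I_r) :
  j = i.+1 :> nat -> ord_pred (rshift r (rev_ord i)) = rshift r (rev_ord j).
Proof.
move=> ij; apply: (@ordS_inj N); rewrite ord_predK; apply: val_inj => /=.
rewrite -addnS subnSK // ij modn_small // ltn_add2l ltn_subrL /=.
exact: leq_ltn_trans (leq0n i) (ltn_ord i).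
Qed.

(** Stepping back from the last unknown enters the conjugated half; this produces the conjugate of
    X_1 in the last equation. *)
Lemma ord_pred_rshift0 (i j : 'I_r) : i.+1 = r -> j = 0%N :> nat ->
  ord_pred (rshift r (rev_ord i)) = lshift r (rev_ord j).
Proof.
move=> ir j0; have r_gt0 : (0 < r)%N by rewrite -ir.
apply: (@ordS_inj N); rewrite ord_predK; apply: val_inj => /=.
rewrite ir j0 subnn addn0 subn1 prednK // modn_small //.
by rewrite -[X in (X < _)%N]addn0 ltn_add2l.
Qed.

Variables (A C : 'I_r -> 'M[F]_m) (B D : 'I_r -> 'M[F]_n).

Let op := @periodic_op F N m n (@ord_pred N) (conj_rev A) (conj_rev C)
                       (conj_rev B) (conj_rev D).

(** The equations at the plain positions are the given system, and the half turn makes the others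
    their conjugates. *)
Lemma is_solution_periodic X :
  is_solution A C B D X <-> op (mx_family (conj_rev_rect X)) = 0.
Proof.
pose E k := conj_rev_rect A k *m conj_rev_rect X k *m conj_rev_rect B k
  - conj_rev_rect C k *m conj_rev_rect X (ord_pred k) *m conj_rev_rect D k.
have opE k : mx_member k (op (mx_family (conj_rev_rect X))) = E k.
  by rewrite /op /periodic_op !mx_familyK.
have E_half k : E (half_turn k) = conj_mx (E k).
  by rewrite /E ord_pred_half_turn !conj_rev_half_turn conj_mxB !conj_mxM.
have E1 (i j : 'I_r) : j = i.+1 :> nat ->
    E (rshift r (rev_ord i)) = A i *m X i *m B i - C i *m X j *m D i.
  by move=> ij; rewrite /E (ord_pred_rshift ij) !conj_rev_rshift.
have E0 (i j : 'I_r) : i.+1 = r -> j = 0%N :> nat ->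
    E (rshift r (rev_ord i)) = A i *m X i *m B i - C i *m conj_mx (X j) *m D i.
  move=> ir j0.
  by rewrite /E (ord_pred_rshift0 ir j0) !conj_rev_rshift conj_rev_lshift.
split=> [[sol sol0]|op0]; last first.
  have E_eq0 k : E k = 0 by rewrite -opE op0 linear0.
  by split=> [i j ij|i j ir j0]; [rewrite -E1 | rewrite -E0].
have Er i : E (rshift r (rev_ord i)) = 0.
  have [lt_ir|] := ltnP i.+1 r.
    by rewrite (@E1 _ (Ordinal lt_ir)) // sol.
  move=> le_ri; have ir : i.+1 = r by apply/eqP; rewrite eqn_leq le_ri ltn_ord.
  have r_gt0 : (0 < r)%N by rewrite -ir.
  by rewrite (@E0 _ (Ordinal r_gt0)) // sol0.
apply: mx_memberP => k; rewrite opE linear0.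
case: (split_ordP k) => j ->; rewrite -[j]rev_ordK; last exact: Er.
by rewrite -half_turn_rshift E_half Er conj_mx0.
Qed.

(* If V solves the linear cyclic system then V + V' comes from a solution of
   the conjugate system, where V' is the conjugate of V turned by r indices;
   applying this to V and to iV gives V = - V' = - V. *)
Lemma conjugate_system_trivialP :
  (forall X, is_solution A C B D X -> forall i, X i = 0) <->
  (forall V, op V = 0 -> V = 0).
Proof.
split=> inj; last first.
  move=> X /is_solution_periodic/inj X0 i.
  have := congr1 (mx_member (rshift r (rev_ord i))) X0.
  by rewrite mx_familyK conj_rev_rshift linear0.
have anti U : op U = 0 ->
    forall k, mx_member k U = - conj_mx (mx_member (half_turn k) U).
  move=> U0 k; apply/eqP; rewrite -addr_eq0; apply/eqP.
  pose W : 'M[F]_(N, m * n) :=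
    mx_family (fun k => mx_member k U + conj_mx (mx_member (half_turn k) U)).
  pose X i := mx_member (rshift r (rev_ord i)) W.
  have half2 l : half_turn (half_turn l) = l.
    case: (split_ordP l) => j ->.
      by rewrite half_turn_lshift half_turn_rshift.
    by rewrite half_turn_rshift half_turn_lshift.
  have WX : W = mx_family (conj_rev_rect X).
    apply: mx_memberP => l; rewrite [RHS]mx_familyK.
    case: (split_ordP l) => j ->; rewrite -[j]rev_ordK;
      last by rewrite conj_rev_rshift.
    rewrite conj_rev_lshift /X /W !mx_familyK -half_turn_rshift half2.
    by rewrite conj_mxD conj_mxK addrC.
  have opU l : conj_rev A l *m mx_member l U *m conj_rev B l
      = conj_rev C l *m mx_member (ord_pred l) U *m conj_rev D l.
    apply/eqP; rewrite -subr_eq0; apply/eqP.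
    by have := congr1 (mx_member l) U0; rewrite mx_familyK linear0.
  have opW : op W = 0.
    apply: mx_memberP => l; rewrite linear0 /op /periodic_op !mx_familyK.
    apply/eqP; rewrite subr_eq0 !mulmxDr !mulmxDl opU; apply/eqP; congr (_ + _).
    apply: (can_inj (@conj_mxK _ _)); rewrite !conj_mxM !conj_mxK.
    have h p (M : 'I_r -> 'M[F]_p) :
        conj_mx (conj_rev M l) = conj_rev M (half_turn l).
      by rewrite -[RHS]/(conj_rev_rect M _) conj_rev_half_turn.
    by rewrite !h opU ord_pred_half_turn.
  have X0 : forall i, X i = 0.
    by apply: inj; apply/is_solution_periodic; rewrite -WX.
  have := congr1 (mx_member k) WX; rewrite !mx_familyK => ->.
  by rewrite /conj_rev_rect; case: split => j; rewrite X0 ?conj_mx0.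
move=> V V0; apply: mx_memberP => k; rewrite linear0.
have e1 := anti V V0 k.
have iV0 : op ('i *: V) = 0 by rewrite /op linearZ /= -/op V0 scaler0.
have := anti _ iV0 k; rewrite !linearZ /= conj_mxZ conjCi scaleNr opprK.
move/(scalerI (neq0Ci F)) => e2.
have : mx_member k V + mx_member k V = 0 by rewrite {1}e1 {1}e2 addNr.
rewrite -mulr2n -scaler_nat => /eqP; rewrite scaler_eq0 pnatr_eq0 /=.
by move/eqP => ->.
Qed.

End ConjugateSystem.

Theorem theorem7 (R : realType) (r m n : nat)
    (hr : (0 < r)%N) (hm : (0 < m)%N) (hn : (0 < n)%N)
    (A C : 'I_r -> 'M[R[i]]_m) (B D : 'I_r -> 'M[R[i]]_n) :
  (forall X : 'I_r -> 'M[R[i]]_(m, n),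
     is_solution A C B D X -> forall i : 'I_r, X i = 0)
  <->
  [/\ regular (pencil1 A C), regular (pencil2 B D)
    & disjoint_spectra (pencil1 A C) (pencil2 B D)].
Proof.
(* Positive sizes ensure that both pencils have nonempty spectra. *)
have sum_gt0 p : (0 < p)%N -> (0 < \sum_(i < r + r) p)%N.
  by move=> p_gt0; rewrite sum_nat_const card_ord muln_gt0 addn_gt0 hr.
rewrite conjugate_system_trivialP -sylvester_injective_block.
exact: (sylvester_injectiveP _ _ (sum_gt0 m hm) (sum_gt0 n hn)).
Qed.
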